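(* Let $d\ge3$. Every $d$-dimensional empirical copula is universally simplified.
   Context: $\mathbb{I}=[0,1]$, $\lambda$ Lebesgue measure. A $d$-dimensional empirical copula is the copula obtained by $d$-linear interpolation of the empirical subcopula of a sample $\mathbf{X}_1,\dots,\mathbf{X}_n$ (without ties) of a $d$-dimensional random vector with continuous marginals; equivalently, there are permutations $\sigma_1,\dots,\sigma_{d-1}$ of $\{1,\dots,n\}$ such that its density is $\hat c_n(\mathbf{u})=n^{d-1}\sum_{i=1}^n\prod_{j=1}^d\mathbf{1}_{I_i^j}(u_j)$ with $I_i^j=((\sigma_j(i)-1)/n,\sigma_j(i)/n]$ for $j\le d-1$ and $I_i^d=((i-1)/n,i/n]$. For a $d$-dimensional copula $C$ and $J\subseteq\{1,\dots,d\}$, $C_J$ denotes the marginal copula of the coordinates in $J$ and $\mu_{C_J}$ its measure. For $J$ with $2\le|J|\le d$ and $L\subseteq J$ with $1\le|L|\le|J|-2$, let $K_{C_J}(\mathbf{t},\cdot)$ be (a version of) the regular conditional distribution of the coordinates in $J\setminus L$ given the coordinates in $L$ equal $\mathbf{t}$ (under $C_J$), so $C_J(\mathbf{u})=\int_{[\mathbf{0},\mathbf{u}_L]}K_{C_J}(\mathbf{t},[\mathbf{0},\mathbf{u}_{J\setminus L}])\,d\mu_{C_L}(\mathbf{t})$, and let $F_{j|L}(\cdot|\mathbf{t})$, $j\in J\setminus L$, be its univariate marginal distribution functions. $C$ is universally simplified if for all such $J,L$ (writing $J\setminus L=\{j_1<\dots<j_m\}$): (U1) there is an $m$-dimensional copula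 $A$ with $C_J(\mathbf{u})=\int_{[\mathbf{0},\mathbf{u}_L]}A(F_{j_1|L}(u_{j_1}|\mathbf{t}),\dots,F_{j_m|L}(u_{j_m}|\mathbf{t}))\,d\mu_{C_L}(\mathbf{t})$ for all $\mathbf{u}\in\mathbb{I}^{|J|}$; and (U2) $F_{j|L}(\cdot|\mathbf{t})$ is continuous for $\mu_{C_L}$-a.e. $\mathbf{t}$, for every $j\in J\setminus L$. *)

(* Defs.v *)
From HB Require Import structures.
From mathcomp Require Import all_boot all_order all_algebra all_fingroup.
From mathcomp Require Import all_classical all_reals all_analysis.
Set Implicit Arguments. Unset Strict Implicit. Unset Printing Implicit Defensive.
Import Order.TTheory GRing.Theory Num.Theory.
Import numFieldNormedType.Exports.
Local Open Scope classical_set_scope.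
Local Open Scope ring_scope.

Definition lbox (R : realType) (k : nat) (v : k.-tuple R) : set (k.-tuple R) :=
  [set y | forall i : 'I_k, 0 <= tnth y i <= tnth v i].

Definition in_cube (R : realType) (k : nat) (v : k.-tuple R) : Prop :=
  forall i : 'I_k, 0 <= tnth v i <= 1.

Definition proj (R : realType) (d : nat) (J : {set 'I_d}) (u : d.-tuple R)
  : #|J|.-tuple R :=
  [tuple tnth u (@enum_val _ (pred_of_set J) i) | i < #|J|].

Definition marg (R : realType) (d : nat) (mu : set (d.-tuple R) -> \bar R)
  (J : {set 'I_d}) : set (#|J|.-tuple R) -> \bar R :=
  pushforward mu (@proj R d J).
Arguments marg {R d} mu J.

Definition marg_copula (R : realType) (d : nat) (mu : set (d.-tuple R) -> \bar R)
  (J : {set 'I_d}) (v : #|J|.-tuple R) : \bar R :=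
  marg mu J (lbox v).

Definition is_copula (R : realType) (m : nat) (A : m.-tuple R -> R) : Prop :=
  [/\ (forall u : m.-tuple R, in_cube u -> (exists k, tnth u k = 0) -> A u = 0),
      (forall (u : m.-tuple R) (k : 'I_m), in_cube u ->
          (forall l, l != k -> tnth u l = 1) -> A u = tnth u k) &
      (forall a b : m.-tuple R, in_cube a -> in_cube b ->
          (forall k, tnth a k <= tnth b k) ->
          0 <= \sum_(e : {ffun 'I_m -> bool})
                 (-1) ^+ #|[set k | ~~ e k]| *
                 A [tuple (if e k then tnth b k else tnth a k) | k < m])].

Fixpoint iter_leb (R : realType) (k : nat) : (k.-tuple R -> \bar R) -> \bar R :=
  match k with
  | 0 => fun f => f [tuple]
  | k'.+1 => fun f =>
      (\int[@lebesgue_measure R]_x iter_leb (fun t : k'.-tuple R => f [tuple of x :: t]))%E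
  end.

(* cell index (0-based) of observation i in coordinate j:
   sigma_j(i) for j < d-1, and i for the last coordinate *)
Definition ecell (d n : nat) (sigma : 'I_d -> {perm 'I_n}) (j : 'I_d) (i : 'I_n) : nat :=
  if (j < d.-1)%N then nat_of_ord (sigma j i) else nat_of_ord i.

Definition emp_density (R : realType) (d n : nat) (sigma : 'I_d -> {perm 'I_n})
  (u : d.-tuple R) : R :=
  n%:R ^+ d.-1 * \sum_(i < n) \prod_(j < d)
    (if ((ecell sigma j i)%:R / n%:R < tnth u j <= (ecell sigma j i).+1%:R / n%:R)
     then 1 else 0).

Definition emp_measure (R : realType) (d n : nat) (sigma : 'I_d -> {perm 'I_n})
  : set (d.-tuple R) -> \bar R :=
  fun B => iter_leb (fun u => ((\1_B u) * emp_density sigma u)%:E).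

Definition cond_df (R : realType) (p m : nat)
  (K : R.-pker (p.-tuple R) ~> (m.-tuple R)) (k : 'I_m) (t : p.-tuple R) (x : R) : R :=
  fine (K t [set y | tnth y k <= x]).

Definition is_rcd (R : realType) (d : nat) (mu : set (d.-tuple R) -> \bar R)
  (J L : {set 'I_d}) (K : R.-pker (#|L|.-tuple R) ~> (#|J :\: L|.-tuple R)) : Prop :=
  forall u : d.-tuple R, in_cube u ->
    marg_copula mu (proj J u) =
    (\int[marg mu L]_(t in lbox (proj L u)) K t (lbox (proj (J :\: L) u)))%E.
Arguments is_rcd {R d} mu J L K.

Definition U1 (R : realType) (d : nat) (mu : set (d.-tuple R) -> \bar R)
  (J L : {set 'I_d}) (K : R.-pker (#|L|.-tuple R) ~> (#|J :\: L|.-tuple R)) : Prop :=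
  exists A : #|J :\: L|.-tuple R -> R, is_copula A /\
    forall u : d.-tuple R, in_cube u ->
      marg_copula mu (proj J u) =
      (\int[marg mu L]_(t in lbox (proj L u))
         (A [tuple cond_df K k t (tnth (proj (J :\: L) u) k) | k < #|J :\: L|])%:E)%E.
Arguments U1 {R d} mu J L K.

Definition U2 (R : realType) (d : nat) (mu : set (d.-tuple R) -> \bar R)
  (J L : {set 'I_d}) (K : R.-pker (#|L|.-tuple R) ~> (#|J :\: L|.-tuple R)) : Prop :=
  forall k : 'I_#|J :\: L|,
    (marg mu L).-negligible [set t | ~ continuous (cond_df K k t)].
Arguments U2 {R d} mu J L K.

Definition universally_simplified (R : realType) (d : nat)
  (mu : set (d.-tuple R) -> \bar R) : Prop :=
  forall J L : {set 'I_d}, (2 <= #|J|)%N -> L \subset J ->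
    (1 <= #|L|)%N -> (#|L| <= #|J| - 2)%N ->
    exists K : R.-pker (#|L|.-tuple R) ~> (#|J :\: L|.-tuple R),
      [/\ is_rcd mu J L K, U1 mu J L K & U2 mu J L K].

(* Main.v *)
(** The empirical copula is the mixture, with weights 1/n, over the observations
of the uniform laws on their boxes (products of cells). In each coordinate the
cells of the n observations partition ]0, 1], so one conditioning coordinate
already determines the observation; given any nonempty set of coordinates the
remaining ones are therefore independent and uniform on cells. Hence the
conditional distribution functions are Lipschitz, and the product copula serves
as the conditional copula for every J and L. *)
Require Import Defs.
From HB Require Import structures.
From mathcomp Require Import all_boot all_order all_algebra all_fingroup.
From mathcomp Require Import all_classical all_reals all_analysis.
From mathcomp Require Import measurable_realfun.
Set Implicit Arguments.
Unset Strict Implicit.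
Unset Printing Implicit Defensive.
Import Order.TTheory GRing.Theory Num.Theory.
Import numFieldNormedType.Exports HBNNSimple.
Import Defs.
Local Open Scope classical_set_scope.
Local Open Scope ring_scope.

(* Unlike in [eq_measure_integral], [m1] and [m2] are bare set functions:
   [emp_measure] is additive only on measurable sets. *)
Lemma integral_eq_on_measurable d (T : measurableType d) (R : realType)
    (m1 m2 : set T -> \bar R) (D : set T) (f : T -> \bar R) :
  (forall A, measurable A -> m1 A = m2 A) ->
  (\int[m1]_(x in D) f x = \int[m2]_(x in D) f x)%E.
Proof.
move=> m12; rewrite /integral.
have E (h : {nnsfun T >-> R}) : sintegral m1 h = sintegral m2 h.
  by rewrite /sintegral; apply: eq_fsbigr => r _; rewrite m12.
by congr (ereal_sup _ - ereal_sup _)%E; apply: eq_imagel => h _; exact: E.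
Qed.

(** * Finite products of probability measures on tuples *)

Section product_probability.
Variable R : realType.

Definition tuple_cons k (z : R * k.-tuple R) : k.+1.-tuple R :=
  [tuple of z.1 :: z.2].

Lemma measurable_tuple_cons k : measurable_fun setT (@tuple_cons k).
Proof. exact: measurable_cons. Qed.

HB.instance Definition _ k :=
  isMeasurableFun.Build _ _ _ _ (@tuple_cons k) (@measurable_tuple_cons k).

(** The recursion peels off the head coordinate exactly as [iter_leb] does, so that the two can be
    compared by induction on [k]. *)
Fixpoint prod_prob (k : nat) : ('I_k -> probability R R) ->
    probability (k.-tuple R) R :=
  match k with
  | 0 => fun _ => \d_[tuple]
  | k'.+1 => fun P =>
      distribution (P ord0 \x prod_prob (fun j => P (lift ord0 j)))%E
        (@tuple_cons k')
  end.

Lemma integral_prod_probS k (P : 'I_k.+1 -> probability R R)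
    (f : k.+1.-tuple R -> \bar R) :
  measurable_fun [set: k.+1.-tuple R] f -> (forall t, 0 <= f t)%E ->
  (\int[prod_prob P]_t f t =
   \int[P ord0]_x \int[prod_prob (fun j => P (lift ord0 j))]_t
     f [tuple of x :: t])%E.
Proof.
move=> mf f0 /=.
rewrite ge0_integral_pushforward//= fubini_tonelli1//.
by apply: measurableT_comp => //; exact: measurable_tuple_cons.
Qed.

Lemma measurable_rect k (B : 'I_k -> set R) : (forall i, measurable (B i)) ->
  measurable [set t : k.-tuple R | forall i, B i (tnth t i)].
Proof.
move=> mB.
rewrite (_ : [set _ | _] = \big[setI/setT]_(i < k) ((@tnth k R ^~ i) @^-1` B i)).
  apply: bigsetI_measurable => i _.
  by rewrite -[X in measurable X]setTI; exact: measurable_tnth.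
rewrite -bigcap_seq; apply/seteqP; split=> t /= H i; first by move=> _; exact: H.
by apply: (H i); rewrite /= mem_index_enum.
Qed.

(** Under [tuple_cons] a rectangle pulls back to its head side times the rectangle of the remaining
    sides. *)
Lemma prod_prob_rect k (P : 'I_k -> probability R R) (B : 'I_k -> set R) :
  (forall i, measurable (B i)) ->
  (prod_prob P [set t | forall i, B i (tnth t i)] = \prod_(i < k) P i (B i))%E.
Proof.
elim: k P B => [P B mB|k IH P B mB].
  rewrite big_ord0 /= diracE mem_set//; by case.
rewrite big_ord_recl /= /distribution /pushforward.
rewrite -IH//.
rewrite -product_measure1E//; last first.
  by apply: (@measurable_rect _ (fun i => B (lift ord0 i))).
congr (_ _); apply/seteqP; split => -[x t] /=.
  move=> H; split; first exact: (H ord0).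
  by move=> i; have := H (lift ord0 i); rewrite tnthS.
move=> [Bx H] i; case: (unliftP ord0 i) => [j ->|-> //].
by rewrite tnthS; exact: H.
Qed.

End product_probability.

(** * Measurability and linearity of iterated Lebesgue integrals *)

Section iterated_lebesgue.
Variable R : realType.

Lemma iter_leb_ge0 k (f : k.-tuple R -> \bar R) :
  (forall t, 0 <= f t)%E -> (0 <= iter_leb f)%E.
Proof.
elim: k f => [f|k IH f] f0 //=.
by apply: integral_ge0 => x _; exact: IH.
Qed.

Lemma eq_iter_leb k (f g : k.-tuple R -> \bar R) : f =1 g ->
  iter_leb f = iter_leb g.
Proof. by move=> /funext ->. Qed.

(** The parameter space [S] is arbitrary so that the induction can pass to [S * R]: the head
    coordinate becomes an extra parameter of the inner integral, and Tonelli handles the outer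
    one. *)
Lemma measurable_iter_leb d (S : measurableType d) k
    (f : S * k.-tuple R -> \bar R) :
  measurable_fun [set: S * k.-tuple R] f -> (forall z, 0 <= f z)%E ->
  measurable_fun [set: S] (fun s => iter_leb (fun t => f (s, t))).
Proof.
elim: k d S f => [|k IH] d S f mf f0 /=.
  by apply: measurableT_comp => //; exact: measurable_fun_pair.
pose g (z : (S * measurableTypeR R) * k.-tuple R) :=
  f (z.1.1, [tuple of z.1.2 :: z.2]).
have mg : measurable_fun setT g.
  apply: measurableT_comp => //; apply: measurable_fun_pair.
    exact: measurableT_comp.
  by apply: measurable_cons => //; exact: measurableT_comp.
apply: (@measurable_fun_fubini_tonelli_F _ _ _ _ _ (@lebesgue_measure R)
  (fun z => iter_leb (fun t => g (z, t)))).
  by apply: (IH _ _ g mg) => z; exact: f0.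
by move=> z; apply: iter_leb_ge0 => t; exact: f0.
Qed.

Lemma measurable_iter_leb_cons k (f : k.+1.-tuple R -> \bar R) :
  measurable_fun [set: k.+1.-tuple R] f -> (forall t, 0 <= f t)%E ->
  measurable_fun [set: measurableTypeR R]
    (fun x => iter_leb (fun t : k.-tuple R => f [tuple of x :: t])).
Proof.
move=> mf f0.
apply: (@measurable_iter_leb _ (measurableTypeR R) k
  (fun z => f [tuple of z.1 :: z.2])) => //.
apply: measurableT_comp => //.
exact: measurable_cons.
Qed.

Lemma measurable_comp_cons k (f : k.+1.-tuple R -> \bar R) (x : R) :
  measurable_fun [set: k.+1.-tuple R] f ->
  measurable_fun [set: k.-tuple R] (fun t => f [tuple of x :: t]).
Proof.
by move=> mf; apply: measurableT_comp => //; exact: measurable_cons.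
Qed.

Lemma iter_leb_sum k (I : Type) (s : seq I) (f : I -> k.-tuple R -> \bar R) :
  (forall i, measurable_fun [set: k.-tuple R] (f i)) ->
  (forall i t, 0 <= f i t)%E ->
  iter_leb (fun t => \sum_(i <- s) f i t)%E = (\sum_(i <- s) iter_leb (f i))%E.
Proof.
elim: k f => [//|k IH] f mf f0 /=.
rewrite -ge0_integral_sum//.
- by apply: eq_integral => x _; rewrite IH// => i; exact: measurable_comp_cons.
- by move=> i; exact: measurable_iter_leb_cons.
- by move=> i x _; exact: iter_leb_ge0.
Qed.

Lemma iter_lebZl k (c : R) (f : k.-tuple R -> \bar R) : 0 <= c ->
  measurable_fun [set: k.-tuple R] f -> (forall t, 0 <= f t)%E ->
  iter_leb (fun t => c%:E * f t)%E = (c%:E * iter_leb f)%E.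
Proof.
move=> c0; elim: k f => [//|k IH] f mf f0 /=.
rewrite -ge0_integralZl//.
- by apply: eq_integral => x _; rewrite IH//; exact: measurable_comp_cons.
- exact: measurable_iter_leb_cons.
- by move=> x _; exact: iter_leb_ge0.
Qed.

End iterated_lebesgue.

(** * Uniform laws on the cells of a grid; the sample size is [n.+1], so [N] is nonzero *)

Section cells.
Variables (R : realType) (n : nat).
Local Notation N := (n.+1%:R : R).

Definition cell (c : nat) : set R := [set x | c%:R / N < x <= c.+1%:R / N].

Lemma cell_itv c : cell c = `]c%:R / N, c.+1%:R / N]%classic.
Proof. by apply/seteqP; split=> x; rewrite /= in_itv. Qed.

Lemma cell_lt c : c%:R / N < c.+1%:R / N.
Proof. by rewrite ltr_pM2r ?invr_gt0 ?ltr0n// ltr_nat. Qed.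

Lemma cell_inj c c' x : cell c x -> cell c' x -> c = c'.
Proof.
rewrite /cell /= => /andP[a b] /andP[a' b'].
have := lt_le_trans a b'; have := lt_le_trans a' b.
rewrite !ltr_pM2r ?invr_gt0 ?ltr0n// !ltr_nat !ltnS => h h'.
by apply/eqP; rewrite eqn_leq h' h.
Qed.

Lemma measurable_cell c : measurable (cell c).
Proof. by rewrite cell_itv. Qed.

(* [uniform_prob] and [lebesgue_measure] live on [measurableTypeR R], whose
   measurable structure has the same sets as that of [R] but another display. *)
Definition of_measurableTypeR (x : measurableTypeR R) : R := x.

Let measurable_of_measurableTypeR : measurable_fun setT of_measurableTypeR.
Proof. by move=> _ Y mY; rewrite setTI. Qed.

HB.instance Definition _ := isMeasurableFun.Build _ _ _ _
  of_measurableTypeR measurable_of_measurableTypeR.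

Definition cell_prob (c : nat) : probability R R :=
  distribution (uniform_prob (cell_lt c)) of_measurableTypeR.

Lemma integral_cell_prob c (f : R -> \bar R) :
  measurable_fun [set: R] f -> (forall x, 0 <= f x)%E ->
  (\int[cell_prob c]_x f x =
   N%:E * \int[@lebesgue_measure R]_(x in (cell c : set (measurableTypeR R))) f x)%E.
Proof.
move=> mf f0.
rewrite ge0_integral_pushforward//= preimage_setT.
(* The uniform law is carried by the closed interval; the extra left endpoint is Lebesgue-null. *)
rewrite integral_uniform// cell_itv integral_itv_obnd_cbnd//; last first.
  exact: measurable_funTS.
congr (_%:E * _)%E.
by rewrite -mulrBl -natrB// subSnn mul1r invrK.
Qed.

End cells.

(** * The empirical measure as a mixture of uniform laws on boxes *)

Section empirical_measure.
Variables (R : realType) (n : nat).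
Local Notation N := (n.+1%:R : R).
Local Notation cell := (@cell R n).
Local Notation cell_prob := (@cell_prob R n).

(** Left unnormalised: the factor [N ^+ k] is kept apart, to be combined later with the factor of
    [emp_density]. *)
Definition box_density k (c : 'I_k -> nat) (t : k.-tuple R) : R :=
  \prod_(j < k) \1_(cell (c j)) (tnth t j).

Lemma box_density_ge0 k (c : 'I_k -> nat) t : 0 <= box_density c t.
Proof. by apply: prodr_ge0 => j _. Qed.

Lemma measurable_box_density k (c : 'I_k -> nat) :
  measurable_fun [set: k.-tuple R] (box_density c).
Proof.
rewrite /box_density; apply: measurable_prod => j _.
apply: measurableT_comp => //; last exact: measurable_tnth.
by apply: measurable_indic; exact: measurable_cell.
Qed.

(** Links the abstract product law to the iterated integrals defining [emp_measure]. Each coordinate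
    peeled off by Tonelli contributes one factor [N] and the indicator of one cell. *)
Lemma integral_box_prob k (c : 'I_k -> nat) (g : k.-tuple R -> \bar R) :
  measurable_fun [set: k.-tuple R] g -> (forall t, 0 <= g t)%E ->
  (\int[prod_prob (fun j => cell_prob (c j))]_t g t =
   (N ^+ k)%:E * iter_leb (fun t => (box_density c t)%:E * g t))%E.
Proof.
elim: k c g => [|k IH] c g mg g0.
  rewrite integral_dirac// diracE in_setT expr0 !mul1e /=.
  by rewrite /box_density big_ord0 mul1e.
rewrite integral_prod_probS//.
have mg' x := measurable_comp_cons x mg.
pose h x := (iter_leb (fun t : k.-tuple R =>
  (box_density (fun j => c (lift ord0 j)) t)%:E * g [tuple of x :: t]))%E.
have h0 x : (0 <= h x)%E.
  by apply: iter_leb_ge0 => t; apply: mule_ge0 => //; rewrite lee_fin box_density_ge0.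
have mh : measurable_fun [set: R] h.
  apply: (@measurable_iter_leb _ _ R k (fun z =>
    ((box_density (fun j => c (lift ord0 j)) z.2)%:E
     * g [tuple of z.1 :: z.2])%E)).
    apply: emeasurable_funM.
      apply/measurable_EFinP; apply: measurableT_comp => //.
      exact: measurable_box_density.
    by apply: measurableT_comp => //; exact: measurable_cons.
  by move=> z; apply: mule_ge0 => //; rewrite lee_fin box_density_ge0.
under eq_integral do rewrite IH//.
rewrite integral_cell_prob; last 2 first.
- exact: measurable_funeM.
- by move=> x; apply: mule_ge0; [rewrite lee_fin exprn_ge0|exact: h0].
rewrite ge0_integralZl//; last 3 first.
- exact: measurable_cell.
- exact: measurable_funTS.
- by move=> x _; exact: h0.
rewrite muleA -EFinM -exprS; congr (_ * _)%E.
(* The restriction to the head cell becomes an indicator factor, which moves inside [iter_leb] and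
   completes [box_density]. *)
rewrite integral_mkcond; apply: eq_integral => x _.
transitivity ((\1_(cell (c ord0)) x)%:E * h x)%E.
  rewrite patchE indicE; case: ifPn => _; first by rewrite mul1e.
  by rewrite mul0e.
rewrite /h -iter_lebZl//.
- apply: eq_iter_leb => t.
  rewrite muleA -EFinM /box_density big_ord_recl.
  by under [in RHS]eq_bigr do rewrite tnthS.
- apply: emeasurable_funM => //.
  by apply/measurable_EFinP; exact: measurable_box_density.
- by move=> t; apply: mule_ge0 => //; rewrite lee_fin box_density_ge0.
Qed.

Variables (d : nat) (sigma : 'I_d -> {perm 'I_n.+1}).

Definition obs_prob (i : 'I_n.+1) : probability (d.-tuple R) R :=
  prod_prob (fun j => cell_prob (ecell sigma j i)).

Lemma emp_densityE (u : d.-tuple R) : emp_density sigma u =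
  N ^+ d.-1 * \sum_(i < n.+1) box_density (fun j => ecell sigma j i) u.
Proof.
congr (_ * _); apply: eq_bigr => i _; apply: eq_bigr => j _.
rewrite indicE; case: ifPn => h; first by rewrite mem_set.
by rewrite memNset//; exact/negP.
Qed.

(** The weight comes from [N ^+ d.-1 = N^-1 * N ^+ d], where [N ^+ d] normalises each box.
    Measurability of [B] allows the iterated integral to be taken term by term. *)
Lemma emp_measureE (B : set (d.-tuple R)) : (0 < d)%N -> measurable B ->
  emp_measure sigma B = (N^-1%:E * \sum_(i < n.+1) obs_prob i B)%E.
Proof.
move=> d0 mB.
have mf (i : 'I_n.+1) : measurable_fun [set: d.-tuple R] (fun t =>
    (box_density (fun j => ecell sigma j i) t)%:E * (\1_B t)%:E)%E.
  apply: emeasurable_funM; apply/measurable_EFinP.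
    exact: measurable_box_density.
  exact: measurable_indic.
have f0 (i : 'I_n.+1) t :
    (0 <= (box_density (fun j => ecell sigma j i) t)%:E * (\1_B t)%:E)%E.
  by apply: mule_ge0 => //; rewrite lee_fin box_density_ge0.
transitivity ((N ^+ d.-1)%:E * iter_leb (fun u : d.-tuple R => \sum_(i < n.+1)
    (box_density (fun j => ecell sigma j i) u)%:E * (\1_B u)%:E))%E.
  rewrite -iter_lebZl ?exprn_ge0//.
  - apply: eq_iter_leb => u; rewrite emp_densityE.
    under [in RHS]eq_bigr do rewrite -EFinM.
    rewrite sumEFin -EFinM; congr EFin.
    by rewrite -mulr_suml mulrCA [\1_B u * _]mulrC.
  - exact: emeasurable_sum.
  - by move=> t; apply: sume_ge0.
rewrite iter_leb_sum// !ge0_sume_distrr//.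
- apply: eq_bigr => i _.
  rewrite -[B in obs_prob i B]setIT -integral_indic// integral_box_prob//; last first.
    by apply/measurable_EFinP; exact: measurable_indic.
  rewrite muleA -EFinM; congr (_%:E * _)%E.
  by case: d d0 => // m _; rewrite exprS mulKf.
- by move=> i _; apply: iter_leb_ge0.
Qed.

End empirical_measure.

(** * Distribution functions of cells, and recovery of the observation from one coordinate *)

Section observation_cells.
Variables (R : realType) (n : nat).
Local Notation N := (n.+1%:R : R).
Local Notation cell := (@cell R n).
Local Notation cell_prob := (@cell_prob R n).

Lemma cell_probE c (B : set R) : measurable B ->
  cell_prob c B = (N%:E * @lebesgue_measure R (cell c `&` B))%E.
Proof.
move=> mB; rewrite -[B in LHS]setIT -integral_indic// integral_cell_prob//.
  by rewrite integral_indic 1?setIC//; exact: measurable_cell.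
by apply/measurable_EFinP; exact: measurable_indic.
Qed.

Lemma cell_prob_cell c : cell_prob c (cell c) = 1%E.
Proof.
rewrite cell_probE; last exact: measurable_cell.
rewrite setIid cell_itv lebesgue_measure_itv/= lte_fin cell_lt.
by rewrite -EFinB -EFinM -mulrBl -natrB// subSnn mul1r divff//.
Qed.

(** Cells lie to the right of 0. This reconciles [lbox], bounded below by 0, with [cond_df], which
    has no lower bound. *)
Lemma cell_prob_itv0 c (x : R) : 0 <= x ->
  cell_prob c `]-oo, x]%classic = cell_prob c `[0, x]%classic.
Proof.
move=> x0; rewrite !cell_probE//; congr (_ * @lebesgue_measure R _)%E.
apply/seteqP; split => y /= [cy]; rewrite !in_itv/=.
  move=> yx; split=> //; rewrite yx andbT.
  by case/andP: cy => cy _; apply: le_trans (ltW cy).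
by move=> /andP[].
Qed.

(** The increment is the mass of []x, y]], and the density is at most [N]. *)
Lemma cell_cdf_lipschitz c (x y : R) : x <= y ->
  `|fine (cell_prob c `]-oo, y]%classic) - fine (cell_prob c `]-oo, x]%classic)|
    <= N * (y - x).
Proof.
move=> xy.
have mP (B : set R) : measurable B -> cell_prob c B \is a fin_num.
  by move=> mB; rewrite fin_num_measure.
have -> : cell_prob c `]-oo, y]%classic =
    (cell_prob c `]-oo, x]%classic + cell_prob c `]x, y]%classic)%E.
  rewrite -measureU//; last first.
    apply/seteqP; split => z //=; rewrite !in_itv/= => -[zx /andP[xz _]].
    by have := le_lt_trans zx xz; rewrite ltxx.
  congr (cell_prob c _); apply/seteqP; split => z /=; rewrite !in_itv/=.
    by move=> zy; case: (leP z x) => zx; [left|right].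
  by move=> [zx|/andP[] //]; exact: le_trans xy.
rewrite fineD ?mP// addrAC subrr add0r ger0_norm ?fine_ge0//.
rewrite -lee_fin fineK ?mP// cell_probE//.
rewrite EFinM lee_pmul//.
apply: (@le_trans _ _ (@lebesgue_measure R `]x, y]%classic)).
  by rewrite le_measure ?inE//; apply: measurableI => //; exact: measurable_cell.
rewrite lebesgue_measure_itv/= lte_fin; case: ifPn => //.
by rewrite lee_fin subr_ge0.
Qed.

Lemma continuous_cell_cdf c :
  continuous (fun x => fine (cell_prob c `]-oo, x]%classic)).
Proof.
move=> x; apply/cvgrPdist_le => /= e e0; near=> y.
have L : `|fine (cell_prob c `]-oo, x]%classic)
          - fine (cell_prob c `]-oo, y]%classic)| <= N * `|x - y|.
  case: (leP x y) => xy; last first.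
    by rewrite (gtr0_norm (x := x - y)) ?subr_gt0// cell_cdf_lipschitz// ltW.
  rewrite distrC [`|x - y|]distrC (ger0_norm (x := y - x)) ?subr_ge0//.
  exact: cell_cdf_lipschitz.
apply: le_trans L _; rewrite -ler_pdivlMl//.
near: y; exists (N^-1 * e); first by rewrite /= mulr_gt0 ?invr_gt0.
by move=> z /=; exact: ltW.
Unshelve. all: by end_near. Qed.

Variables (d : nat) (sigma : 'I_d -> {perm 'I_n.+1}).

(** This is the absence of ties: in each coordinate distinct observations occupy distinct cells. *)
Lemma ecell_inj j : injective (ecell sigma j).
Proof.
move=> i i'; rewrite /ecell; case: ifP => _ /val_inj //.
exact: perm_inj.
Qed.

(* The observation whose cell in coordinate [j] contains [x]; [ord0] for [x]
   outside ]0, 1]. *)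
Definition obs_of (j : 'I_d) (x : R) : 'I_n.+1 :=
  odflt ord0 [pick i | x \in cell (ecell sigma j i)].

Lemma obs_ofE j i x : cell (ecell sigma j i) x -> obs_of j x = i.
Proof.
move=> cx; rewrite /obs_of; case: pickP => [i' /set_mem cx'|/(_ i)].
  exact/(@ecell_inj j)/(cell_inj cx' cx).
by rewrite mem_set.
Qed.

Lemma obs_of_neq0 j i x : obs_of j x = i -> i != ord0 ->
  cell (ecell sigma j i) x.
Proof.
rewrite /obs_of; case: pickP => [i' /set_mem cx <- //|_ <-].
by rewrite eqxx.
Qed.

(** Fibres over nonzero indices are cells. The fibre over [ord0] also collects the points in no
    cell, so it is obtained as the complement of the others. *)
Lemma measurable_obs_of_eq j i : measurable (obs_of j @^-1` [set i]).
Proof.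
have neq0 i' : i' != ord0 ->
    obs_of j @^-1` [set i'] = cell (ecell sigma j i').
  move=> i'0; apply/seteqP; split => x /=.
    by move=> /obs_of_neq0; exact.
  exact: obs_ofE.
have [->|i0] := eqVneq i ord0; last by rewrite neq0//; exact: measurable_cell.
rewrite (_ : _ @^-1` _ = ~` \bigcup_(i' in [set i' | i' != ord0])
    obs_of j @^-1` [set i']).
  apply: measurableC; apply: fin_bigcup_measurable; [exact: finite_finset|move=> i' /= i'0].
  by rewrite neq0//; exact: measurable_cell.
apply/seteqP; split => x /=.
  by move=> x0 [i' /= i'0 xi']; move: i'0; rewrite -xi' x0 eqxx.
move=> H; apply/eqP/negPn/negP => x0; apply: H.
by exists (obs_of j x).
Qed.

Lemma measurable_comp_obs_of j d' (T : measurableType d') (F : 'I_n.+1 -> T) :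
  measurable_fun [set: R] (F \o obs_of j).
Proof.
move=> _ Y mY; rewrite setTI.
rewrite (_ : _ @^-1` _ = \bigcup_(i in [set i | Y (F i)]) obs_of j @^-1` [set i]).
  by apply: fin_bigcup_measurable; [exact: finite_finset|move=> i _; exact: measurable_obs_of_eq].
apply/seteqP; split => x /=; first by move=> Yx; exists (obs_of j x).
by move=> [i /= Yi ->].
Qed.

(** Each side of the box has mass 1 under its own cell law, hence so does the box. *)
Lemma obs_prob_cells i :
  obs_prob R sigma i
    (~` [set u | forall j, cell (ecell sigma j i) (tnth u j)]) = 0%E.
Proof.
have mc := @measurable_rect R d _ (fun j => @measurable_cell R n (ecell sigma j i)).
rewrite probability_setC//.
rewrite /obs_prob (prod_prob_rect _ (fun j => @measurable_cell R n (ecell sigma j i))).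
by under eq_bigr do rewrite cell_prob_cell; rewrite big1// subee.
Qed.

End observation_cells.

(** * Marginals of the empirical measure and integrals against them *)

Section marginals.
Variables (R : realType) (n d : nat) (sigma : 'I_d -> {perm 'I_n.+1}).
Local Notation N := (n.+1%:R : R).
Local Notation cell_prob := (@cell_prob R n).

(** Built directly as a product law rather than as an image of [obs_prob], so that [prod_prob_rect]
    applies to it. *)
Definition obs_marg (J : {set 'I_d}) (i : 'I_n.+1) :
    probability (#|J|.-tuple R) R :=
  prod_prob (fun k =>
    cell_prob (ecell sigma (@enum_val _ (pred_of_set J) k) i)).

Lemma measurable_proj (J : {set 'I_d}) :
  measurable_fun [set: d.-tuple R] (@proj R d J).
Proof.
apply/measurable_fun_tnthP => k.
rewrite (_ : _ \o _ = fun u : d.-tuple R => tnth u (enum_val k)).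
  exact: measurable_tnth.
by apply/funext => u /=; rewrite tnth_mktuple.
Qed.

HB.instance Definition _ (J : {set 'I_d}) :=
  isMeasurableFun.Build _ _ _ _ (@proj R d J) (@measurable_proj J).

Lemma lboxE k (v : k.-tuple R) :
  lbox v = [set y | forall i, `[0, tnth v i]%classic (tnth y i)].
Proof. by apply/seteqP; split=> y H i; have := H i; rewrite /= in_itv. Qed.

Lemma measurable_lbox k (v : k.-tuple R) : measurable (lbox v).
Proof. by rewrite lboxE; apply: (measurable_rect (B := fun i => `[0, tnth v i]%classic)).
Qed.

(** Writes the cylinder as a full rectangle, free in the coordinates outside [J], so that its mass
    is a product over all coordinates. *)
Lemma preimage_proj_lbox (J : {set 'I_d}) u : proj J @^-1` lbox (proj J u) =
  [set y : d.-tuple R | forall j,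
    (if j \in J then `[0, tnth u j]%classic else setT) (tnth y j)].
Proof.
apply/seteqP; split => y /= H.
  move=> j; case: ifP => // jJ.
  have := H (enum_rank_in jJ j).
  by rewrite !tnth_mktuple enum_rankK_in// in_itv.
move=> k; rewrite !tnth_mktuple.
by have := H (enum_val k); rewrite enum_valP /= in_itv.
Qed.

Lemma obs_prob_proj_lbox (J : {set 'I_d}) i u :
  obs_prob R sigma i (proj J @^-1` lbox (proj J u)) =
  (\prod_(j in J) cell_prob (ecell sigma j i) `[0%R, tnth u j]%classic)%E.
Proof.
rewrite preimage_proj_lbox /obs_prob
  (prod_prob_rect _ (B := fun j => if j \in J then `[0, tnth u j]%classic else setT)).
  rewrite [RHS]big_mkcond; apply: eq_bigr => j _.
  by case: ifP => // _; rewrite probability_setT.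
by move=> j; case: ifP.
Qed.

Lemma obs_marg_lbox (J : {set 'I_d}) i u :
  obs_marg J i (lbox (proj J u)) =
  (\prod_(j in J) cell_prob (ecell sigma j i) `[0%R, tnth u j]%classic)%E.
Proof.
rewrite lboxE /obs_marg
  (prod_prob_rect _ (B := fun k => `[0, tnth (proj J u) k]%classic))//.
rewrite [RHS]big_enum_val; apply: eq_bigr => k _.
by rewrite tnth_mktuple.
Qed.

Lemma obs_marg_cdf (J : {set 'I_d}) i (k : 'I_#|J|) x :
  obs_marg J i [set y | tnth y k <= x] =
  cell_prob (ecell sigma (@enum_val _ (pred_of_set J) k) i) `]-oo, x]%classic.
Proof.
rewrite (_ : [set y | _] = [set y : #|J|.-tuple R | forall l,
    (if l == k then `]-oo, x]%classic else setT) (tnth y l)]).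
  rewrite /obs_marg
    (prod_prob_rect _ (B := fun l => if l == k then `]-oo, x]%classic else setT)).
    rewrite (bigD1 k)//= eqxx big1 ?mule1// => l /negbTE ->.
    by rewrite probability_setT.
  by move=> l; case: ifP.
apply/seteqP; split => y /=.
  by move=> yx l; case: eqVneq => // ->; rewrite /= in_itv.
by move=> /(_ k); rewrite eqxx /= in_itv.
Qed.

(** Almost every point for the law of observation [i] lies in its box, where [obs_of] returns [i];
    the integrand is thus almost everywhere the constant [h i]. *)
Lemma integral_obs_of_obs_prob (D : set (d.-tuple R)) (h : 'I_n.+1 -> \bar R)
    (j : 'I_d) i : measurable D -> (forall i, 0 <= h i)%E ->
  (\int[obs_prob R sigma i]_(u in D) h (obs_of sigma j (tnth u j)) =
   h i * obs_prob R sigma i D)%E.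
Proof.
move=> mD h0; rewrite -integral_cst//.
apply: ge0_ae_eq_integral => //.
  apply: measurable_funTS.
  apply: (@measurableT_comp _ _ _ _ _ _ (h \o obs_of sigma j)).
    exact: measurable_comp_obs_of.
  exact: measurable_tnth.
  by move=> u _; exact: h0.
exists (~` [set u | forall j, cell n (ecell sigma j i) (tnth u j)]); split.
- apply: measurableC; apply: (measurable_rect (B := fun j' => cell n (ecell sigma j' i))) => j'.
  exact: measurable_cell.
- exact: obs_prob_cells.
- move=> u /= H cu; apply: H => _.
  by rewrite (obs_ofE (cu j)).
Qed.

Hypothesis d_gt0 : (0 < d)%N.

Lemma marg_copulaE (J : {set 'I_d}) u :
  marg_copula (emp_measure sigma) (proj J u) = (N^-1%:E *
    \sum_(i < n.+1) \prod_(j in J)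
      cell_prob (ecell sigma j i) `[0%R, tnth u j]%classic)%E.
Proof.
rewrite /marg_copula /marg /pushforward emp_measureE//; last first.
  by rewrite -[X in measurable X]setTI; apply: measurable_proj => //; exact: measurable_lbox.
by under eq_bigr do rewrite obs_prob_proj_lbox.
Qed.

(** Reduces integrals over the conditioning coordinates to finite sums: the marginal is replaced by
    a genuine measure, the scaled sum of image laws, agreeing with it on measurable sets. *)
Lemma integral_marg_obs_of (L : {set 'I_d}) (D : set (#|L|.-tuple R))
    (l : 'I_#|L|) (h : 'I_n.+1 -> \bar R) :
  measurable D -> (forall i, 0 <= h i)%E ->
  (\int[marg (emp_measure sigma) L]_(t in D)
     h (obs_of sigma (@enum_val _ (pred_of_set L) l) (tnth t l)) =
   N^-1%:E * \sum_(i < n.+1) h i * obs_prob R sigma i (proj L @^-1` D))%E.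
Proof.
move=> mD h0; set j := enum_val l.
have mproj (A : set (#|L|.-tuple R)) : measurable A -> measurable (proj L @^-1` A).
  by move=> mA; rewrite -[X in measurable X]setTI; exact: measurable_proj.
have mh : measurable_fun D (fun t : #|L|.-tuple R => h (obs_of sigma j (tnth t l))).
  apply: measurable_funTS.
  apply: (@measurableT_comp _ _ _ _ _ _ (h \o obs_of sigma j)).
    exact: measurable_comp_obs_of.
  exact: measurable_tnth.
have N0 : 0 <= N^-1 by rewrite invr_ge0.
(* [msum] takes a sequence indexed by [nat], hence [inord]; only indices below [n.+1] enter the
   sum. *)
pose M (i : nat) := distribution (obs_prob R sigma (inord i)) (@proj R d L).
rewrite (@integral_eq_on_measurable _ _ _ _ (mscale (NngNum N0) (msum M n.+1))).
  rewrite ge0_integral_mscale// ge0_integral_measure_sum//.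
  congr (_ * _)%E; apply: eq_bigr => i _.
  rewrite /M inord_val ge0_integral_pushforward//.
  rewrite -(@integral_obs_of_obs_prob _ h j)//; last exact: mproj.
  by apply: eq_integral => u _ /=; rewrite tnth_mktuple.
move=> A mA; rewrite /marg /pushforward emp_measureE//; last exact: mproj.
rewrite /mscale /msum /=; congr (_ * _)%E; apply: eq_bigr => i _.
by rewrite /M inord_val.
Qed.

End marginals.

(** * The conditional kernel, the product copula and the conclusion *)

Section conditional_kernel.
Variables (R : realType) (n d : nat) (sigma : 'I_d -> {perm 'I_n.+1}).
Variables (L A : {set 'I_d}) (l : 'I_#|L|).

(* A single conditioning coordinate identifies the observation, so the
   conditional law is uniform on the box of that observation. *)
Definition obs_kernel (t : #|L|.-tuple R) :
    {measure set (#|A|.-tuple R) -> \bar R} :=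
  obs_marg R sigma A (obs_of sigma (@enum_val _ (pred_of_set L) l) (tnth t l)).

Let measurable_obs_kernel U : measurable U ->
  measurable_fun [set: #|L|.-tuple R] (obs_kernel ^~ U).
Proof.
move=> mU.
apply: (@measurableT_comp _ _ _ _ _ _
  ((fun i => obs_marg R sigma A i U) \o obs_of sigma (enum_val l))).
  exact: measurable_comp_obs_of.
exact: measurable_tnth.
Qed.

HB.instance Definition _ :=
  isKernel.Build _ _ _ _ R obs_kernel measurable_obs_kernel.

Let obs_kernel_setT t : obs_kernel t [set: #|A|.-tuple R] = 1%E.
Proof. exact: probability_setT. Qed.

HB.instance Definition _ :=
  Kernel_isProbability.Build _ _ _ _ R obs_kernel obs_kernel_setT.

End conditional_kernel.

(** By distributivity, the alternating sum over the vertices of a box is the product of its side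
    lengths [b_k - a_k]. *)
Lemma prod_is_copula (R : realType) m :
  is_copula (fun v : m.-tuple R => \prod_(k < m) tnth v k).
Proof.
split.
- by move=> u _ [k uk0]; rewrite (bigD1 k)//= uk0 mul0r.
- by move=> u k _ u1; rewrite (bigD1 k)//= big1 ?mulr1.
move=> a b _ _ ab.
have -> : \sum_(e : {ffun 'I_m -> bool}) (-1) ^+ #|[set k | ~~ e k]| *
    \prod_(k < m) tnth [tuple (if e k then tnth b k else tnth a k) | k < m] k =
    \prod_(k < m) \sum_(c : bool) (if c then tnth b k else - tnth a k) :> R.
  rewrite bigA_distr_bigA; apply: eq_bigr => e _.
  (* The sign is spread over the coordinates, one factor -1 for each lower endpoint chosen. *)
  rewrite -prodr_const big_mkcond -big_split; apply: eq_bigr => k _ /=.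
  rewrite tnth_mktuple (_ : (k \in _) = ~~ e k); last exact: asboolb.
  by case: (e k); rewrite ?mul1r// mulN1r.
by apply: prodr_ge0 => k _; rewrite big_bool/= subr_ge0.
Qed.
Theorem theorem7p1 (R : realType) (d n : nat) (sigma : 'I_d -> {perm 'I_n}) :
  (3 <= d)%N -> (0 < n)%N ->
  universally_simplified (emp_measure (R := R) sigma).
Proof.
move=> d3; case: n sigma => // n sigma _ J L J2 LJ L1 _.
have d0 : (0 < d)%N by apply: leq_trans d3.
(* Any coordinate of [L] identifies the observation; the first is taken. *)
pose l : 'I_#|L| := Ordinal L1.
pose K : R.-pker (#|L|.-tuple R) ~> (#|J :\: L|.-tuple R) :=
  obs_kernel sigma (J :\: L) l.
have rcd : is_rcd (emp_measure sigma) J L K.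
  move=> u _; rewrite marg_copulaE//.
  rewrite (@integral_marg_obs_of _ _ _ _ d0 _ _ l
    (fun i => obs_marg R sigma (J :\: L) i (lbox (proj (J :\: L) u))))//; last first.
    exact: measurable_lbox.
  (* For each observation the product over [J] splits into the mass of the conditioning box over [L]
     and the kernel mass over [J :\: L]. *)
  congr (_ * _)%E; apply: eq_bigr => i _.
  rewrite obs_marg_lbox obs_prob_proj_lbox (finset.big_setID L)/= (finset.setIidPr LJ).
  by rewrite muleC.
exists K; split => //.
  exists (fun v => \prod_k tnth v k); split; first exact: prod_is_copula.
  (* Given [rcd], it suffices that the integrands agree pointwise: the kernel mass of a box is the
     product of its conditional distribution functions. *)
  move=> u u01; rewrite rcd//; congr (integral _ _ _); apply/funext => t.
  rewrite /K /= /obs_kernel obs_marg_lbox big_enum_val -prodEFin.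
  apply: eq_bigr => k _.
  rewrite !tnth_mktuple /cond_df /= /obs_kernel obs_marg_cdf cell_prob_itv0.
    by rewrite fineK// fin_num_measure.
  by have /andP[] := u01 (enum_val k).
(* Continuity holds for every [t], so the exceptional set is empty. *)
move=> k; exists set0; split => //.
  by rewrite /marg /pushforward preimage_set0 emp_measureE// big1 ?mule0.
move=> t /= H; apply: H.
rewrite (_ : cond_df K k t = fun x => fine (cell_prob R n
  (ecell sigma (enum_val k) (obs_of sigma (enum_val l) (tnth t l))) `]-oo, x]%classic)).
  exact: continuous_cell_cdf.
by apply/funext => x; rewrite /cond_df /= /obs_kernel obs_marg_cdf.
Qed.
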